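(* Let $r\in\mathbb R$ and $n\ge \frac15$. Let $\mu_0,\mu_1,\dots,\mu_\ell$ be the sequence of distributions obtained by applying a weight-constrained sequence of moves to an initial distribution $\mu_0$ with $\mu_0\{x>r\}=0$. If $\mu_{\max}\{x>r\}\le n$, then $\mu_{\max}\{x>r+6n^{1/3}-1\}=0$.
   Context: A (discrete mass) distribution is a finite set $\mu=\{(x_1,m_1),\dots,(x_k,m_k)\}$ with $x_i\in\mathbb R$ and $m_i>0$; a signed distribution is the same without the positivity requirement. For $A\subseteq\mathbb R$, $\mu(A)=\sum_{x_i\in A}m_i$, and $\mu\{x>a\}$ means $\mu(\{x:x>a\})$, etc. Moments: $M_j[\mu]=\sum_i m_ix_i^j$. A move $v=([a,b],\delta)$ consists of an interval with $b-a=1$ and a signed distribution $\delta$ supported in $[a,b]$ with $M_0[\delta]=M_1[\delta]=0$; its center is $\frac{a+b}2$. It can be applied to $\mu$ if $\mu+\delta$ is a distribution, and then $v\mu=\mu+\delta$. A sequence of moves $v_1,\dots,v_\ell$ applied to $\mu_0$ produces $\mu_i=v_i\mu_{i-1}$. For such a sequence, $\mu_{\max}\{x>a\}=\max_{0\le i\le\ell}\mu_i\{x>a\}$ (similarly for $\ge$). The sequence is weight-constrained (with respect to $\mu_0$) if for every $a\in\mathbb R$ the number of moves whose center lies in $(a,\infty)$ is at most $\mu_{\max}\{x>a\}$. *)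

(* Defs.v *)
From Stdlib Require Import Reals Lra List.
Import ListNotations.
Open Scope R_scope.

(* A signed distribution: a finite list of (point, mass) pairs; the
   measure it represents is the sum of its point masses (repeated points
   add up).  A (nonnegative) distribution is one whose measure is
   nonnegative at every point. *)
Definition sdist := list (R * R).

Definition massAt (mu : sdist) (x : R) : R :=
  fold_right (fun p acc => (if Req_EM_T (fst p) x then snd p else 0) + acc) 0 mu.

Definition IsDist (mu : sdist) : Prop := forall x, 0 <= massAt mu x.

Definition mass_gt (mu : sdist) (a : R) : R :=
  fold_right (fun p acc => (if Rlt_dec a (fst p) then snd p else 0) + acc) 0 mu.

Definition M0 (mu : sdist) : R := fold_right (fun p acc => snd p + acc) 0 mu.
Definition M1 (mu : sdist) : R := fold_right (fun p acc => snd p * fst p + acc) 0 mu.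

Record move := Move { mv_left : R; mv_delta : sdist }.

Definition mv_center (v : move) : R := mv_left v + / 2.

Definition ValidMove (v : move) : Prop :=
  (forall p, In p (mv_delta v) -> mv_left v <= fst p <= mv_left v + 1) /\
  M0 (mv_delta v) = 0 /\ M1 (mv_delta v) = 0.

Definition state (mu0 : sdist) (vs : list move) (i : nat) : sdist :=
  mu0 ++ concat (map mv_delta (firstn i vs)).

Definition Applicable (mu0 : sdist) (vs : list move) : Prop :=
  (forall v, In v vs -> ValidMove v) /\
  (forall i, (1 <= i <= length vs)%nat -> IsDist (state mu0 vs i)).

Definition mumax_gt (mu0 : sdist) (vs : list move) (a : R) : R :=
  fold_right (fun i acc => Rmax (mass_gt (state mu0 vs i) a) acc)
    (mass_gt mu0 a) (seq 0 (S (length vs))).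

Definition count_center_gt (vs : list move) (a : R) : nat :=
  length (filter (fun v => if Rlt_dec a (mv_center v) then true else false) vs).

Definition WeightConstrained (mu0 : sdist) (vs : list move) : Prop :=
  forall a : R, INR (count_center_gt vs a) <= mumax_gt mu0 vs a.

(* Main.v *)
Require Import Defs.
From Stdlib Require Import Reals List.
From Stdlib Require Import Arith Lra Lia.
From Coquelicot Require Import Coquelicot.
Import ListNotations.
Open Scope R_scope.

(** Let [G_mu(t)] be the integral of [(x - t)_+] against [mu].  A move on [[a, a + 1]] changes
    [G] only inside the interval, where by convexity it stays below its chord.  Hence, right
    of [z = r + 1], [G] is dominated by the function [H_nu] of a process [nu] of total mass [n]
    that starts as an atom at [z] and always performs the extreme move (replace [H] by its
    chord), sweeping mass left of [z] back to [z].

    With [f = mass_gt nu], the energy [∫ f^2 + 2 (lam (t - z) - n) f dt] over [t >= z] starts at 0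
    and grows by at most [lam^2 / 12] per extreme move, so it never exceeds [n lam^2 / 12].
    For [n = s^3 >= 8] and [lam = 3 s^2] this forces [H_nu(z + s)] to be so small that the mass
    beyond [r + 2.49 s] is at most [n / 5].  As [6 s - 6 (n / 5)^(1/3) >= 2.49 s], one concludes by
    induction from [n / 5] to [n]; for [s <= 2] the at most [n] moves reach no further than
    [r + 1 + n <= r + 6 s - 1]. *)

(** * Linear functionals of distributions *)

Definition lsum (phi : R -> R) (mu : sdist) : R :=
  fold_right (fun p acc => snd p * phi (fst p) + acc) 0 mu.

Definition ind_gt (t x : R) : R := if Rlt_dec t x then 1 else 0.

Definition hinge (t x : R) : R := Rmax 0 (x - t).

(** The integral of [ind_gt t x] over [t] in [[a, a + 1]]. Hence [lsum (ramp a) nu] is the mean of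
    the tail mass over the interval, and minus the slope of the chord of [H_nu]. *)
Definition ramp (a x : R) : R := Rmax a (Rmin (a + 1) x) - a.

Ltac cases_R :=
  unfold ind_gt, hinge, ramp, Rmax, Rmin in *;
  repeat match goal with
  | |- context [Rle_dec ?x ?y] => destruct (Rle_dec x y)
  | |- context [Rlt_dec ?x ?y] => destruct (Rlt_dec x y)
  | _ : context [Rle_dec ?x ?y] |- _ => destruct (Rle_dec x y)
  end.

Lemma lsum_app phi mu nu : lsum phi (mu ++ nu) = lsum phi mu + lsum phi nu.
Proof. unfold lsum; induction mu as [|p mu IH]; simpl; [ring|rewrite IH; ring]. Qed.

Lemma lsum_ext phi psi mu :
  (forall p, In p mu -> phi (fst p) = psi (fst p)) -> lsum phi mu = lsum psi mu.
Proof.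
  unfold lsum; induction mu as [|p mu IH]; simpl; intros H; [reflexivity|].
  rewrite (H p), IH; auto.
Qed.

Lemma lsum_lin al be phi psi mu :
  lsum (fun x => al * phi x + be * psi x) mu = al * lsum phi mu + be * lsum psi mu.
Proof. unfold lsum; induction mu as [|p mu IH]; simpl; [ring|rewrite IH; ring]. Qed.

Lemma M0_lsum mu : M0 mu = lsum (fun _ => 1) mu.
Proof. unfold M0, lsum; induction mu as [|p mu IH]; simpl; lra. Qed.

Lemma M1_lsum mu : M1 mu = lsum (fun x => x) mu.
Proof. unfold M1, lsum; induction mu as [|p mu IH]; simpl; lra. Qed.

Lemma mass_gt_lsum mu t : mass_gt mu t = lsum (ind_gt t) mu.
Proof.
  unfold mass_gt, lsum, ind_gt; induction mu as [|p mu IH]; simpl; [ring|].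
  rewrite IH; destruct (Rlt_dec t (fst p)); ring.
Qed.

Lemma lsum_split_point phi x mu :
  lsum phi mu = massAt mu x * phi x +
    lsum phi (filter (fun p => if Req_EM_T (fst p) x then false else true) mu).
Proof.
  unfold lsum, massAt; induction mu as [|p mu IH]; simpl; [ring|].
  rewrite IH; destruct (Req_EM_T (fst p) x) as [e|e]; simpl; [rewrite e|]; ring.
Qed.

Lemma massAt_filter_ne x y mu :
  massAt (filter (fun p => if Req_EM_T (fst p) x then false else true) mu) y =
  if Req_EM_T x y then 0 else massAt mu y.
Proof.
  unfold massAt; induction mu as [|p mu IH]; simpl; [destruct (Req_EM_T x y); ring|].
  destruct (Req_EM_T (fst p) x) as [e|e]; simpl; rewrite IH;
  destruct (Req_EM_T x y); destruct (Req_EM_T (fst p) y); try ring; congruence.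
Qed.

(* The entries of a distribution may be negative as long as the masses add up to
   something nonnegative at each point, so all copies of a point go together. *)
Lemma lsum_dist_ge0 phi mu :
  IsDist mu -> (forall p, In p mu -> 0 <= phi (fst p)) -> 0 <= lsum phi mu.
Proof.
  remember (length mu) as k eqn:Hk; revert mu Hk.
  induction k as [k IH] using (well_founded_induction Wf_nat.lt_wf).
  intros [|p mu] Hk Hd Hphi; [unfold lsum; simpl; lra|].
  rewrite (lsum_split_point phi (fst p)).
  set (mu' := filter _ _).
  assert (0 <= lsum phi mu').
  { apply (IH (length mu')); auto.
    - subst mu' k; simpl; destruct (Req_EM_T (fst p) (fst p)); [|congruence].
      apply Nat.lt_succ_r, filter_length_le.
    - intros y; unfold mu'; rewrite massAt_filter_ne.
      destruct (Req_EM_T (fst p) y); [lra|apply Hd].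
    - intros q Hq; apply Hphi; apply filter_In in Hq; tauto. }
  assert (0 <= massAt (p :: mu) (fst p) * phi (fst p)).
  { apply Rmult_le_pos; [apply Hd|apply Hphi; left; reflexivity]. }
  lra.
Qed.

(** Reduces the inequalities between masses and excesses below to pointwise inequalities between
    test functions. *)
Lemma lsum_dist_le phi psi mu :
  IsDist mu -> (forall p, In p mu -> phi (fst p) <= psi (fst p)) ->
  lsum phi mu <= lsum psi mu.
Proof.
  intros Hd H.
  assert (0 <= lsum (fun x => 1 * psi x + (-1) * phi x) mu).
  { apply lsum_dist_ge0; [exact Hd|]; intros p Hp; specialize (H p Hp); lra. }
  rewrite lsum_lin in H0; lra.
Qed.

(** Stronger than [IsDist], which only sees total masses at points. The comparison process can
    maintain it because [spread] acts entry by entry. *)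
Definition nonneg (nu : sdist) : Prop := forall p, In p nu -> 0 <= snd p.

Lemma nonneg_IsDist nu : nonneg nu -> IsDist nu.
Proof.
  intros H x; unfold massAt; induction nu as [|p nu IH]; simpl; [lra|].
  assert (0 <= snd p) by (apply H; left; reflexivity).
  assert (Hn : nonneg nu) by (intros q Hq; apply H; right; exact Hq).
  specialize (IH Hn); destruct (Req_EM_T (fst p) x); lra.
Qed.

(** * Tail mass and excess *)

Lemma mass_gt_ge0 mu t : IsDist mu -> 0 <= mass_gt mu t.
Proof.
  intros H; rewrite mass_gt_lsum; apply lsum_dist_ge0; [exact H|].
  intros p _; cases_R; lra.
Qed.

Lemma mass_gt_antitone mu s t : IsDist mu -> s <= t -> mass_gt mu t <= mass_gt mu s.
Proof.
  intros H Hst; rewrite !mass_gt_lsum; apply lsum_dist_le; [exact H|].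
  intros p _; cases_R; lra.
Qed.

Lemma list_bounded {A : Type} (f : A -> R) (l : list A) :
  exists C, 0 <= C /\ forall p, In p l -> f p <= C.
Proof.
  induction l as [|p l [C [HC H]]]; [exists 0; split; [lra|intros p []]|].
  exists (Rmax C (f p)); split; [cases_R; lra|].
  intros q [->|Hq]; [cases_R; lra|specialize (H q Hq); cases_R; lra].
Qed.

Lemma excess_eq0 mu t : IsDist mu -> mass_gt mu t = 0 -> lsum (hinge t) mu <= 0.
Proof.
  intros Hd H0.
  destruct (list_bounded (fun p : R * R => fst p - t) mu) as [C [HC HB]].
  (* The vanishing second term gives the two-term shape of [lsum_lin]. *)
  replace 0 with (C * mass_gt mu t + 0 * mass_gt mu t) by (rewrite H0; ring).
  rewrite mass_gt_lsum, <- lsum_lin.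
  apply lsum_dist_le; [exact Hd|]; intros p Hp; specialize (HB p Hp); simpl in HB; cases_R; lra.
Qed.

Lemma excess_antitone mu s t :
  IsDist mu -> s <= t -> lsum (hinge t) mu <= lsum (hinge s) mu.
Proof.
  intros Hd Hst; apply lsum_dist_le; [exact Hd|]; intros p _; cases_R; lra.
Qed.

Lemma excess_markov mu s t :
  IsDist mu -> s <= t -> (t - s) * mass_gt mu t <= lsum (hinge s) mu.
Proof.
  intros Hd Hst; rewrite mass_gt_lsum.
  replace ((t - s) * lsum (ind_gt t) mu)
    with ((t - s) * lsum (ind_gt t) mu + 0 * lsum (ind_gt t) mu) by ring.
  rewrite <- lsum_lin; apply lsum_dist_le; [exact Hd|]; intros p _; cases_R; lra.
Qed.

Lemma mass_gt_of_excess mu t : IsDist mu -> lsum (hinge t) mu <= 0 -> mass_gt mu t = 0.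
Proof.
  intros Hd H.
  assert (He : exists C, 0 <= C /\ forall p, In p mu -> ind_gt t (fst p) <= C * hinge t (fst p)).
  (* The finitely many atoms beyond [t] keep a positive distance from it, so reciprocal distances
     are bounded; at the other entries the indicator is zero. *)
  { destruct (list_bounded (fun p : R * R => / (fst p - t)) mu) as [C [HC HB]].
    exists C; split; [exact HC|].
    intros p Hp; specialize (HB p Hp); simpl in HB; cases_R; try lra; [|nra].
    apply Rmult_le_compat_r with (r := fst p - t) in HB; [|lra].
    rewrite Rinv_l in HB by lra; lra. }
  destruct He as [C [HC HB]].
  assert (mass_gt mu t <= C * lsum (hinge t) mu + 0 * lsum (hinge t) mu).
  { rewrite mass_gt_lsum, <- lsum_lin; apply lsum_dist_le; [exact Hd|].
    intros p Hp; specialize (HB p Hp); lra. }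
  pose proof (mass_gt_ge0 mu t Hd); nra.
Qed.

(** The excess falls at a rate equal to the tail mass, which is at most [n] right of [r]. *)
Lemma excess_slope mu r n s t :
  IsDist mu -> mass_gt mu r <= n -> r <= s -> s <= t ->
  lsum (hinge s) mu <= lsum (hinge t) mu + n * (t - s).
Proof.
  intros Hd Hn Hrs Hst.
  assert (lsum (hinge s) mu <= 1 * lsum (hinge t) mu + (t - s) * lsum (ind_gt r) mu).
  { rewrite <- lsum_lin; apply lsum_dist_le; [exact Hd|]; intros p _; cases_R; lra. }
  rewrite <- mass_gt_lsum in H; nra.
Qed.

Lemma excess_convex mu a t :
  IsDist mu -> a <= t <= a + 1 ->
  lsum (hinge t) mu <= (a + 1 - t) * lsum (hinge a) mu + (t - a) * lsum (hinge (a + 1)) mu.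
Proof.
  intros Hd Ht; rewrite <- lsum_lin; apply lsum_dist_le; [exact Hd|].
  intros p _; cases_R; nra.
Qed.

(** For such [t], [hinge t] is affine or zero on the support of the move, and affine functions are
    killed by [M0 = M1 = 0]. *)
Lemma excess_move v t :
  ValidMove v -> t <= mv_left v \/ mv_left v + 1 <= t -> lsum (hinge t) (mv_delta v) = 0.
Proof.
  intros [Hs [H0 H1]] [Ht|Ht].
  - rewrite (lsum_ext _ (fun x => 1 * x + (- t) * 1)).
    + rewrite (lsum_lin 1 (- t) (fun x => x) (fun _ => 1)), <- M1_lsum, <- M0_lsum, H0, H1; ring.
    + intros p Hp; specialize (Hs p Hp); cases_R; lra.
  - rewrite (lsum_ext _ (fun x => 0 * x + 0 * 1)).
    + rewrite (lsum_lin 0 0 (fun x => x) (fun _ => 1)); ring.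
    + intros p Hp; specialize (Hs p Hp); cases_R; lra.
Qed.

(** * The extreme move *)

(* The extreme move on [a, a + 1]: every point mass in the interval is split between the
   endpoints with the same barycentre.  Mass landing left of [z] is then swept to [z]. *)
Definition spread (z a : R) (nu : sdist) : sdist :=
  flat_map (fun p =>
    if Rle_dec a (fst p) then
      if Rle_dec (fst p) (a + 1) then
        [(Rmax a z, snd p * (a + 1 - fst p)); (a + 1, snd p * (fst p - a))]
      else [p]
    else [p]) nu.

(** Transfers the operation to the test function, so that the effects of [spread] become pointwise
    identities. *)
Lemma lsum_spread phi z a nu :
  lsum phi (spread z a nu) =
  lsum (fun x => if Rle_dec a x then
                   if Rle_dec x (a + 1) then (a + 1 - x) * phi (Rmax a z) + (x - a) * phi (a + 1)
                   else phi x
                 else phi x) nu.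
Proof.
  induction nu as [|p nu IH]; [reflexivity|].
  unfold spread in *; simpl; rewrite lsum_app, IH; unfold lsum at 1 3; simpl.
  destruct (Rle_dec a (fst p)); [destruct (Rle_dec (fst p) (a + 1))|]; simpl; unfold lsum; ring.
Qed.

(** Sweeping is invisible from [t >= z], since mass at [z] is not beyond [t]. *)
Lemma spread_mass_out z a nu t :
  z <= t -> t < a \/ a + 1 <= t -> mass_gt (spread z a nu) t = mass_gt nu t.
Proof.
  intros Hz Ht; rewrite !mass_gt_lsum, lsum_spread; apply lsum_ext; intros p _.
  cases_R; lra.
Qed.

(** No mass is left strictly between [Rmax a z] and [a + 1]; [ramp] is the fraction of an entry that
    ends up at or beyond [a + 1]. *)
Lemma spread_mass_in z a nu t :
  z <= t -> a <= t < a + 1 -> mass_gt (spread z a nu) t = lsum (ramp a) nu.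
Proof.
  intros Hz Ht; rewrite !mass_gt_lsum, lsum_spread; apply lsum_ext; intros p _.
  cases_R; lra.
Qed.

Lemma spread_M0 z a nu : M0 (spread z a nu) = M0 nu.
Proof.
  rewrite !M0_lsum, lsum_spread; apply lsum_ext; intros p _; cases_R; lra.
Qed.

Lemma spread_excess_out z a nu t :
  z <= t -> t <= a \/ a + 1 <= t -> lsum (hinge t) (spread z a nu) = lsum (hinge t) nu.
Proof.
  intros Hz Ht; rewrite lsum_spread; apply lsum_ext; intros p _; cases_R; nra.
Qed.

(** The extreme move attains equality in [excess_convex]. *)
Lemma spread_excess_in z a nu t :
  z <= t -> a <= t <= a + 1 ->
  lsum (hinge t) (spread z a nu) =
  (a + 1 - t) * lsum (hinge a) nu + (t - a) * lsum (hinge (a + 1)) nu.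
Proof.
  intros Hz Ht; rewrite lsum_spread, <- lsum_lin; apply lsum_ext; intros p _; cases_R; nra.
Qed.

Lemma spread_In z a nu q :
  In q (spread z a nu) ->
  exists p, In p nu /\ (q = p \/ a <= fst p <= a + 1 /\
    (fst q = Rmax a z /\ snd q = snd p * (a + 1 - fst p) \/
     fst q = a + 1 /\ snd q = snd p * (fst p - a))).
Proof.
  unfold spread; rewrite in_flat_map; intros [p [Hp Hq]]; exists p; split; [exact Hp|].
  destruct (Rle_dec a (fst p)); [destruct (Rle_dec (fst p) (a + 1))|];
    simpl in Hq; [|intuition|intuition].
  destruct Hq as [<-|[<-|[]]]; right; simpl; split; intuition.
Qed.

(** * Integrals of tail masses *)

Lemma is_RInt_const_R (k u v : R) : is_RInt (fun _ => k) u v ((v - u) * k).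
Proof. exact (@is_RInt_const R_NormedModule u v k). Qed.

Lemma is_RInt_ind_gt x u v :
  u <= v -> is_RInt (fun t => ind_gt t x) u v (Rmax u (Rmin v x) - u).
Proof.
  intros Huv; set (y := Rmax u (Rmin v x)).
  assert (Hy : u <= y <= v) by (unfold y; cases_R; lra).
  replace (y - u) with ((y - u) * 1 + (v - y) * 0) by ring.
  apply (@is_RInt_Chasles R_NormedModule _ u y v).
  - apply is_RInt_ext with (fun _ => 1); [|apply is_RInt_const_R].
    rewrite Rmin_left, Rmax_right by lra; intros t Ht; unfold y in Ht; revert Ht.
    cases_R; intros; lra.
  - apply is_RInt_ext with (fun _ => 0); [|apply is_RInt_const_R].
    rewrite Rmin_left, Rmax_right by lra; intros t Ht; unfold y in Ht; revert Ht.
    cases_R; intros; lra.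
Qed.

Lemma is_RInt_mass_gt nu u v :
  u <= v -> is_RInt (mass_gt nu) u v (lsum (fun x => Rmax u (Rmin v x) - u) nu).
Proof.
  intros Huv.
  apply is_RInt_ext with (fun t => lsum (ind_gt t) nu); [intros t _; symmetry; apply mass_gt_lsum|].
  unfold lsum; induction nu as [|p nu IH]; simpl.
  - pose proof (is_RInt_const_R 0 u v) as H; rewrite Rmult_0_r in H; exact H.
  - apply (is_RInt_plus (fun t => snd p * ind_gt t (fst p))); [|exact IH].
    apply (is_RInt_scal (fun t => ind_gt t (fst p)) u v (snd p)), is_RInt_ind_gt, Huv.
Qed.

Lemma ex_RInt_ind_gt_mult x (h : R -> R) u v :
  u <= v -> ex_RInt h u v -> ex_RInt (fun t => ind_gt t x * h t) u v.
Proof.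
  intros Huv Hh; set (y := Rmax u (Rmin v x)).
  assert (Hy : u <= y <= v) by (unfold y; cases_R; lra).
  apply ex_RInt_Chasles with y.
  - apply ex_RInt_ext with h; [|apply (ex_RInt_Chasles_1 (V := R_CompleteNormedModule) h u y v); assumption].
    rewrite Rmin_left, Rmax_right by lra; intros t Ht; unfold y in Ht; revert Ht.
    cases_R; intros; lra.
  - apply ex_RInt_ext with (fun _ => 0); [|apply ex_RInt_const].
    rewrite Rmin_left, Rmax_right by lra; intros t Ht; unfold y in Ht; revert Ht.
    cases_R; intros; lra.
Qed.

(** Tail masses are step functions, so continuity does not give integrability of their squares.
    Splitting off one factor does, which suits the product form of [energy_density]. *)
Lemma ex_RInt_mass_gt_mult nu (h : R -> R) u v :
  u <= v -> ex_RInt h u v -> ex_RInt (fun t => mass_gt nu t * h t) u v.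
Proof.
  intros Huv Hh.
  apply ex_RInt_ext with (fun t => lsum (ind_gt t) nu * h t);
    [intros t _; rewrite mass_gt_lsum; reflexivity|].
  unfold lsum; induction nu as [|p nu IH]; simpl.
  - apply ex_RInt_ext with (fun _ => 0); [intros; symmetry; apply Rmult_0_l|apply ex_RInt_const].
  - apply ex_RInt_ext with (fun t => plus (scal (snd p) (ind_gt t (fst p) * h t))
      (fold_right (fun p0 acc => snd p0 * ind_gt t (fst p0) + acc) 0 nu * h t)).
    + intros t _; unfold plus, scal; simpl; unfold mult; simpl; rewrite <- Rmult_assoc; symmetry; apply Rmult_plus_distr_r.
    + apply (ex_RInt_plus (fun t => scal (snd p) (ind_gt t (fst p) * h t))); [|exact IH].
      apply (ex_RInt_scal (fun t => ind_gt t (fst p) * h t)), ex_RInt_ind_gt_mult; assumption.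
Qed.

Lemma is_RInt_square k m u v :
  is_RInt (fun t => (k * (t - m)) ^ 2) u v (k ^ 2 * ((v - m) ^ 3 - (u - m) ^ 3) / 3).
Proof.
  replace (k ^ 2 * ((v - m) ^ 3 - (u - m) ^ 3) / 3)
    with (minus (k ^ 2 * (v - m) ^ 3 / 3) (k ^ 2 * (u - m) ^ 3 / 3))
    by (unfold minus, plus, opp; simpl; field).
  apply (is_RInt_derive (fun t => k ^ 2 * (t - m) ^ 3 / 3)).
  - intros t _; auto_derive; [exact I|field].
  - intros t _; apply (ex_derive_continuous (fun t => (k * (t - m)) ^ 2)); auto_derive; exact I.
Qed.

(** * The energy and its growth *)

Definition energy_density (z n lam : R) (nu : sdist) (t : R) : R :=
  mass_gt nu t * (mass_gt nu t + 2 * (lam * (t - z) - n)).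

Definition energy (z n lam K : R) (nu : sdist) : R :=
  RInt (energy_density z n lam nu) z K.

Lemma ex_RInt_mass_gt nu u v : u <= v -> ex_RInt (mass_gt nu) u v.
Proof. intros H; eexists; apply is_RInt_mass_gt, H. Qed.

Lemma ex_RInt_energy_density z n lam nu u v :
  u <= v -> ex_RInt (energy_density z n lam nu) u v.
Proof.
  intros Huv; apply ex_RInt_mass_gt_mult; [exact Huv|].
  apply (ex_RInt_plus (mass_gt nu) (fun t => 2 * (lam * (t - z) - n)));
    [apply ex_RInt_mass_gt, Huv|].
  apply (ex_RInt_continuous (V := R_CompleteNormedModule)); intros t _.
  apply (ex_derive_continuous (fun t => 2 * (lam * (t - z) - n))); auto_derive; exact I.
Qed.

Lemma energy_density_Chasles z n lam nu u v w :
  u <= v -> v <= w ->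
  RInt (energy_density z n lam nu) u w =
  RInt (energy_density z n lam nu) u v + RInt (energy_density z n lam nu) v w.
Proof.
  intros Huv Hvw; symmetry.
  apply (RInt_Chasles (energy_density z n lam nu)); apply ex_RInt_energy_density; assumption.
Qed.

Lemma energy_spread_left z n lam K a nu :
  z <= K -> a + 1 <= z -> energy z n lam K (spread z a nu) = energy z n lam K nu.
Proof.
  intros HK Ha; apply RInt_ext; rewrite Rmin_left, Rmax_right by exact HK; intros t Ht.
  unfold energy_density; rewrite spread_mass_out; [reflexivity|lra|right; lra].
Qed.

(* Completing squares bounds the gain in energy density by a function whose integral
   over the whole of [a, a + 1] is known. *)
Definition gain (n lam z a : R) (nu : sdist) (t : R) : R :=
  (lam * (t - (a + / 2))) ^ 2
  - 2 * (lsum (ramp a) nu - n + lam * (a + / 2 - z)) * (mass_gt nu t - lsum (ramp a) nu).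

(** The right side exceeds the left by exactly the square [(f - c + lam * (t - (a + / 2))) ^ 2],
    with [f] the tail mass and [c] its mean over the interval. *)
Lemma density_gain z n lam a nu t :
  z <= t -> a <= t < a + 1 ->
  energy_density z n lam (spread z a nu) t <= energy_density z n lam nu t + gain n lam z a nu t.
Proof.
  intros Hz Ht; unfold energy_density, gain; rewrite spread_mass_in by assumption.
  set (c := lsum _ _); set (f := mass_gt _ _).
  pose proof (pow2_ge_0 (f - c + lam * (t - (a + / 2)))); nra.
Qed.

(** The linear term integrates to zero because [lsum (ramp a) nu] is the mean of the tail mass; the
    centred square gives [lam ^ 2 / 12]. *)
Lemma is_RInt_gain n lam z a nu : is_RInt (gain n lam z a nu) a (a + 1) (lam ^ 2 / 12).
Proof.
  unfold gain; set (c := lsum _ _); set (k := 2 * _).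
  pose proof (is_RInt_square lam (a + / 2) a (a + 1)) as H1.
  assert (H2 : is_RInt (mass_gt nu) a (a + 1) c) by (apply is_RInt_mass_gt; lra).
  pose proof (is_RInt_const_R c a (a + 1)) as H3.
  pose proof (is_RInt_minus _ _ _ _ _ _ H1
    (is_RInt_scal _ _ _ k _ (is_RInt_minus _ _ _ _ _ _ H2 H3))) as H.
  unfold minus, plus, opp, scal in H; simpl in H; unfold mult in H; simpl in H.
  replace (lam ^ 2 / 12) with
    (lam * (lam * 1) * ((a + 1 - (a + / 2)) * ((a + 1 - (a + / 2)) * ((a + 1 - (a + / 2)) * 1))
      - (a - (a + / 2)) * ((a - (a + / 2)) * ((a - (a + / 2)) * 1))) / 3
      + - (k * (c + - ((a + 1 - a) * c)))) by field.
  apply is_RInt_ext with (2 := H); intros t _; simpl; ring.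
Qed.

Lemma ex_RInt_gain n lam z a nu u v :
  a <= u -> u <= v -> v <= a + 1 -> ex_RInt (gain n lam z a nu) u v.
Proof.
  intros Hu Huv Hv.
  apply (ex_RInt_Chasles_1 (V := R_CompleteNormedModule) _ u v (a + 1)); [lra|].
  apply (ex_RInt_Chasles_2 (V := R_CompleteNormedModule) _ a u (a + 1)); [lra|].
  eexists; apply is_RInt_gain.
Qed.

(* Left of [z] the gain is nonnegative, so discarding that part of the interval costs nothing. *)
Lemma RInt_gain_left n lam z a nu :
  0 <= lam -> nonneg nu -> M0 nu = n -> (forall p, In p nu -> z <= fst p) -> a <= z <= a + 1 ->
  0 <= RInt (gain n lam z a nu) a z.
Proof.
  intros Hlam Hnn HM Hz Ha.
  apply RInt_ge_0; [lra|apply ex_RInt_gain; lra|].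
  intros t Ht; unfold gain.
  replace (mass_gt nu t) with n.
  - assert (Hc : lsum (ramp a) nu <= n).
    { rewrite <- HM, M0_lsum; apply lsum_dist_le; [apply nonneg_IsDist, Hnn|].
      intros p _; cases_R; lra. }
    set (c := lsum _ _) in *.
    (* With tail mass [n], [d = n - c] and [w = lam * (t - (a + / 2))], the gain equals [(w + d) ^ 2
       + d ^ 2 + 2 * d * lam * (z - t)]. *)
    pose proof (pow2_ge_0 (lam * (t - (a + / 2)) - (c - n))).
    assert (0 <= (n - c) * (lam * (z - t))) by (apply Rmult_le_pos; [|apply Rmult_le_pos]; lra).
    nra.
  - rewrite <- HM, M0_lsum, mass_gt_lsum; apply lsum_ext; intros p Hp.
    specialize (Hz p Hp); cases_R; lra.
Qed.

Lemma energy_spread z n lam K a nu :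
  0 <= lam -> nonneg nu -> M0 nu = n -> (forall p, In p nu -> z <= fst p) ->
  z <= K -> a + 1 <= K ->
  energy z n lam K (spread z a nu) <= energy z n lam K nu + lam ^ 2 / 12.
Proof.
  intros Hlam Hnn HM Hz HzK HaK.
  destruct (Rle_dec (a + 1) z) as [Haz|Haz].
  { rewrite energy_spread_left by assumption; nra. }
  (* On [[z, K]] the density changes only inside [[b, a + 1]]. *)
  set (b := Rmax a z).
  assert (Hb : a <= b /\ z <= b /\ b <= a + 1) by (unfold b; cases_R; lra).
  unfold energy.
  rewrite (energy_density_Chasles _ _ _ (spread z a nu) z b K),
    (energy_density_Chasles _ _ _ (spread z a nu) b (a + 1) K),
    (energy_density_Chasles _ _ _ nu z b K),
    (energy_density_Chasles _ _ _ nu b (a + 1) K) by lra.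
  assert (E1 : RInt (energy_density z n lam (spread z a nu)) z b =
               RInt (energy_density z n lam nu) z b).
  { apply RInt_ext; rewrite Rmin_left, Rmax_right by lra; intros t Ht.
    unfold energy_density; rewrite spread_mass_out; [reflexivity|lra|].
    left; unfold b in Ht; revert Ht; cases_R; lra. }
  assert (E2 : RInt (energy_density z n lam (spread z a nu)) (a + 1) K =
               RInt (energy_density z n lam nu) (a + 1) K).
  { apply RInt_ext; rewrite Rmin_left, Rmax_right by lra; intros t Ht.
    unfold energy_density; rewrite spread_mass_out; [reflexivity|lra|right; lra]. }
  assert (E3 : RInt (energy_density z n lam (spread z a nu)) b (a + 1) <=
               RInt (energy_density z n lam nu) b (a + 1) + RInt (gain n lam z a nu) b (a + 1)).
  { replace (RInt (energy_density z n lam nu) b (a + 1) + RInt (gain n lam z a nu) b (a + 1))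
      with (RInt (fun t => energy_density z n lam nu t + gain n lam z a nu t) b (a + 1)).
    - apply RInt_le; [lra|apply ex_RInt_energy_density; lra| |].
      + apply (ex_RInt_plus (energy_density z n lam nu));
          [apply ex_RInt_energy_density|apply ex_RInt_gain]; lra.
      + intros t Ht; apply density_gain; lra.
    - apply (RInt_plus (energy_density z n lam nu));
        [apply ex_RInt_energy_density|apply ex_RInt_gain]; lra. }
  assert (E4 : RInt (gain n lam z a nu) a b + RInt (gain n lam z a nu) b (a + 1) = lam ^ 2 / 12).
  { rewrite <- (is_RInt_unique _ _ _ _ (is_RInt_gain n lam z a nu)).
    apply (RInt_Chasles (gain n lam z a nu)); apply ex_RInt_gain; lra. }
  assert (E5 : 0 <= RInt (gain n lam z a nu) a b).
  { unfold b, Rmax; destruct (Rle_dec a z).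
    - apply RInt_gain_left; auto; lra.
    - rewrite RInt_point; unfold zero; simpl; lra. }
  lra.
Qed.

(** * The energy bounded below by the excess *)

Lemma RInt_mass_gt_tail nu u K :
  u <= K -> (forall p, In p nu -> fst p <= K) -> RInt (mass_gt nu) u K = lsum (hinge u) nu.
Proof.
  intros HuK HK; rewrite (is_RInt_unique _ _ _ _ (is_RInt_mass_gt nu u K HuK)).
  apply lsum_ext; intros p Hp; specialize (HK p Hp); cases_R; lra.
Qed.

(* The density is bounded below by comparing [mass_gt nu] with the profile
   [max 0 (n - lam (t - z))] left of [z + s] and [max 0 (4 n - lam (t - z))] right of it. *)
Lemma energy_lower_bound z s K nu :
  0 < s -> z + 2 * s <= K -> nonneg nu -> (forall p, In p nu -> fst p <= K) ->
  6 * s ^ 3 * lsum (hinge (z + s)) nu - 2 * s ^ 7 / 9 <= energy z (s ^ 3) (3 * s ^ 2) K nu.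
Proof.
  intros Hs HzK Hnn HK.
  assert (Hs2 : 0 < s ^ 2) by (apply pow_lt; exact Hs).
  assert (Hf : forall t, 0 <= mass_gt nu t) by (intros t; apply mass_gt_ge0, nonneg_IsDist, Hnn).
  set (f := mass_gt nu) in *; set (q := energy_density z (s ^ 3) (3 * s ^ 2) nu).
  assert (Hq : forall t, q t = f t ^ 2 + 2 * (3 * s ^ 2 * (t - (z + s / 3))) * f t).
  { intros t; unfold q, energy_density; fold f; field. }
  unfold energy; fold q.
  assert (Hex : forall u v, u <= v -> ex_RInt q u v) by (intros; apply ex_RInt_energy_density; lra).
  assert (Hexf : forall u v, u <= v -> ex_RInt f u v) by (intros; apply ex_RInt_mass_gt; lra).
  (* Since [n / lam = s / 3], the two profiles vanish at [z + s / 3] and [z + 4 * s / 3]. Right of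
     [z + s], write [q = f ^ 2 + 2 * (lam * (t - z) - 4 * n) * f + 6 * n * f]; the last term
     integrates to the excess. Each profile costs [s ^ 7 / 9]. *)
  unfold q; rewrite (energy_density_Chasles _ _ _ _ z (z + s / 3) K),
    (energy_density_Chasles _ _ _ _ (z + s / 3) (z + s) K),
    (energy_density_Chasles _ _ _ _ (z + s) (z + 4 * s / 3) K) by lra.
  fold q.
  assert (P1 : - (s ^ 7 / 9) <= RInt q z (z + s / 3)).
  { pose proof (is_RInt_square (3 * s ^ 2) (z + s / 3) z (z + s / 3)) as H.
    apply (is_RInt_opp (V := R_NormedModule)) in H; unfold opp in H; simpl opp in H.
    replace (- (s ^ 7 / 9)) with
      (- ((3 * s ^ 2) ^ 2 * ((z + s / 3 - (z + s / 3)) ^ 3 - (z - (z + s / 3)) ^ 3) / 3)) by field.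
    apply (is_RInt_le _ q _ _ _ _) with (2 := H) (3 := RInt_correct _ _ _ (Hex z (z + s / 3) ltac:(lra)));
      [lra|].
    intros t Ht; rewrite Hq; simpl.
    pose proof (pow2_ge_0 (f t + 3 * s ^ 2 * (t - (z + s / 3)))); nra. }
  assert (P2 : 0 <= RInt q (z + s / 3) (z + s)).
  { apply RInt_ge_0; [lra|apply Hex; lra|].
    intros t Ht; rewrite Hq; specialize (Hf t).
    assert (0 <= 3 * s ^ 2 * (t - (z + s / 3)) * f t)
      by (apply Rmult_le_pos; [apply Rmult_le_pos|]; lra).
    pose proof (pow2_ge_0 (f t)); lra. }
  assert (P3 : 6 * s ^ 3 * RInt f (z + s) (z + 4 * s / 3) - s ^ 7 / 9
               <= RInt q (z + s) (z + 4 * s / 3)).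
  { pose proof (is_RInt_square (3 * s ^ 2) (z + 4 * s / 3) (z + s) (z + 4 * s / 3)) as H.
    assert (H2 : is_RInt f (z + s) (z + 4 * s / 3) (RInt f (z + s) (z + 4 * s / 3)))
      by (apply (@RInt_correct R_CompleteNormedModule), Hexf; lra).
    apply (is_RInt_scal _ _ _ (6 * s ^ 3)) in H2.
    pose proof (is_RInt_minus _ _ _ _ _ _ H2 H) as H3.
    replace (6 * s ^ 3 * RInt f (z + s) (z + 4 * s / 3) - s ^ 7 / 9) with
      (6 * s ^ 3 * RInt f (z + s) (z + 4 * s / 3) - (3 * s ^ 2) ^ 2 *
         ((z + 4 * s / 3 - (z + 4 * s / 3)) ^ 3 - (z + s - (z + 4 * s / 3)) ^ 3) / 3) by field.
    apply (is_RInt_le _ q _ _ _ _) with (2 := H3)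
      (3 := RInt_correct _ _ _ (Hex (z + s) (z + 4 * s / 3) ltac:(lra))); [lra|].
    intros t Ht; rewrite Hq; unfold minus, plus, opp, scal; simpl; unfold mult; simpl.
    pose proof (pow2_ge_0 (f t + 3 * s ^ 2 * (t - (z + 4 * s / 3)))); nra. }
  assert (P4 : 6 * s ^ 3 * RInt f (z + 4 * s / 3) K <= RInt q (z + 4 * s / 3) K).
  { assert (H2 : is_RInt f (z + 4 * s / 3) K (RInt f (z + 4 * s / 3) K))
      by (apply (@RInt_correct R_CompleteNormedModule), Hexf; lra).
    apply (is_RInt_scal _ _ _ (6 * s ^ 3)) in H2.
    apply (is_RInt_le _ q _ _ _ _) with (2 := H2)
      (3 := RInt_correct _ _ _ (Hex (z + 4 * s / 3) K ltac:(lra))); [lra|].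
    intros t Ht; rewrite Hq; unfold scal; simpl; unfold mult; simpl.
    specialize (Hf t).
    assert (0 <= 3 * s ^ 2 * (t - (z + 4 * s / 3)) * f t)
      by (apply Rmult_le_pos; [apply Rmult_le_pos|]; lra).
    pose proof (pow2_ge_0 (f t)); nra. }
  assert (P5 : RInt f (z + s) (z + 4 * s / 3) + RInt f (z + 4 * s / 3) K = lsum (hinge (z + s)) nu).
  { rewrite <- (RInt_mass_gt_tail nu (z + s) K) by (auto; lra).
    apply (RInt_Chasles f); apply Hexf; lra. }
  rewrite <- P5; lra.
Qed.

(** * Domination along a sequence of moves *)

(* [nu] is what remains of an extreme-move process that has absorbed the moves leading to
   [mu], [k] of them centered right of [r]. *)
Record dominates (r n lam K : R) (mu nu : sdist) (k : nat) : Prop := {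
  dom_nonneg : nonneg nu;
  dom_mass : M0 nu = n;
  dom_left : forall p, In p nu -> r + 1 <= fst p;
  dom_right : forall p, In p nu -> fst p <= K;
  dom_reach : forall p, In p nu -> fst p <= r + 1 + INR k;
  dom_excess : forall t, r + 1 <= t -> lsum (hinge t) mu <= lsum (hinge t) nu;
  dom_energy : energy (r + 1) n lam K nu <= INR k * (lam ^ 2 / 12)
}.

Definition center_gt (r : R) (v : move) : nat := if Rlt_dec r (mv_center v) then 1 else 0.

(** An atom at [r + 1] has no energy, and no excess from [r + 1] on; neither has [mu] any excess
    there. *)
Lemma dominates_init r n lam K mu :
  0 <= n -> r + 1 <= K -> IsDist mu -> mass_gt mu r = 0 ->
  dominates r n lam K mu [(r + 1, n)] 0.
Proof.
  intros Hn HK Hd H0; constructor; simpl; try (intros p [<-|[]]; simpl; lra).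
  - unfold M0; simpl; ring.
  - intros t Ht; apply Rle_trans with 0.
    + apply Rle_trans with (lsum (hinge r) mu); [apply excess_antitone; [exact Hd|lra]|].
      apply excess_eq0; assumption.
    + unfold lsum; simpl; cases_R; nra.
  - unfold energy; rewrite RInt_ext with (g := fun _ => 0).
    + rewrite RInt_const; unfold scal; simpl; unfold mult; simpl; lra.
    + rewrite Rmin_left, Rmax_right by exact HK; intros t Ht.
      unfold energy_density, mass_gt; simpl; cases_R; lra.
Qed.

Lemma dominates_step r n lam K mu nu k v :
  0 <= lam -> r + 1 <= K -> ValidMove v -> mv_left v + 1 <= K ->
  IsDist mu -> mass_gt mu r <= n -> IsDist (mu ++ mv_delta v) ->
  dominates r n lam K mu nu k ->
  dominates r n lam K (mu ++ mv_delta v) (spread (r + 1) (mv_left v) nu) (center_gt r v + k).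
Proof.
  intros Hlam HrK Hv HaK Hd Hn Hd' [Hnn HM HL HR HT HE HF].
  set (a := mv_left v) in *.
  assert (Hout : forall t, t <= a \/ a + 1 <= t ->
            lsum (hinge t) (mu ++ mv_delta v) = lsum (hinge t) mu).
  { intros t Ht; rewrite lsum_app, excess_move by assumption; ring. }
  constructor.
  - intros q Hq; apply spread_In in Hq; destruct Hq as [p [Hp [->|[Ha [[_ ->]|[_ ->]]]]]];
      [auto| |]; apply Rmult_le_pos; auto; lra.
  - rewrite spread_M0; exact HM.
  - intros q Hq; apply spread_In in Hq; destruct Hq as [p [Hp [->|[Ha [[-> _]|[-> _]]]]]];
      specialize (HL p Hp); cases_R; lra.
  - intros q Hq; apply spread_In in Hq; destruct Hq as [p [Hp [->|[Ha [[-> _]|[-> _]]]]]];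
      specialize (HR p Hp); cases_R; lra.
  - intros q Hq; apply spread_In in Hq; rewrite plus_INR.
    pose proof (pos_INR (center_gt r v)); pose proof (pos_INR k).
    destruct Hq as [p [Hp [->|[Ha Hq]]]]; specialize (HT p Hp); [lra|].
    specialize (HL p Hp).
    (* An interval containing an atom of [nu] has [a >= r], so its centre lies beyond [r] and the
       move is counted. *)
    assert (Hc : INR (center_gt r v) = 1).
    { unfold center_gt, mv_center; fold a; destruct (Rlt_dec r (a + / 2)); [reflexivity|lra]. }
    destruct Hq as [[-> _]|[-> _]]; cases_R; lra.
  - intros t Ht.
    destruct (Rle_dec t a) as [Hta|Hta];
      [rewrite Hout, spread_excess_out by (auto; lra); auto|].
    destruct (Rle_dec (a + 1) t) as [Hat|Hat];
      [rewrite Hout, spread_excess_out by (auto; lra); auto|].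
    rewrite spread_excess_in by lra.
    apply Rle_trans with (1 := excess_convex _ a t Hd' ltac:(lra)).
    rewrite !Hout by lra.
    assert (H1 : lsum (hinge (a + 1)) mu <= lsum (hinge (a + 1)) nu) by (apply HE; lra).
    assert (H2 : lsum (hinge a) mu <= lsum (hinge a) nu).
    { destruct (Rle_dec (r + 1) a) as [Hra|Hra]; [apply HE, Hra|].
      (* As [t >= r + 1] lies in the interval, [a >= r]: this is why [z = r + 1]. Going left from
         [r + 1], the excess of [mu] grows at rate at most [n] and that of [nu] at rate exactly
         [n]. *)
      apply Rle_trans with (1 := excess_slope mu r n a (r + 1) Hd Hn ltac:(lra) ltac:(lra)).
      apply Rle_trans with (lsum (hinge (r + 1)) nu + n * (r + 1 - a));
        [apply Rplus_le_compat_r, HE; lra|].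
      rewrite <- HM, M0_lsum.
      apply Req_le; rewrite Rmult_comm, <- (Rmult_1_l (lsum (hinge (r + 1)) nu)), <- lsum_lin.
      apply lsum_ext; intros p Hp; specialize (HL p Hp); cases_R; lra. }
    apply Rplus_le_compat; apply Rmult_le_compat_l; lra.
  (* A move that is not counted ends at or before [r + / 2], left of [z], and leaves the energy
     unchanged. *)
  - unfold center_gt, mv_center; fold a; destruct (Rlt_dec r (a + / 2)) as [Hc|Hc].
    + rewrite plus_INR; simpl INR.
      pose proof (energy_spread (r + 1) n lam K a nu Hlam Hnn HM HL HrK HaK); lra.
    + rewrite energy_spread_left by lra; exact HF.
Qed.

Lemma dominates_run r n lam K vs :
  0 <= lam -> r + 1 <= K ->
  (forall v, In v vs -> ValidMove v /\ mv_left v + 1 <= K) ->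
  forall mu nu k,
  (forall i, (i <= length vs)%nat -> IsDist (state mu vs i) /\ mass_gt (state mu vs i) r <= n) ->
  dominates r n lam K mu nu k ->
  forall i, (i <= length vs)%nat ->
  exists nu' k', dominates r n lam K (state mu vs i) nu' k' /\
    (k' <= k + count_center_gt vs r)%nat.
Proof.
  intros Hlam HrK; induction vs as [|v vs IH]; intros Hvs mu nu k Hst Hdom i Hi.
  - exists nu, k; unfold state; simpl in Hi; replace i with 0%nat by lia; simpl.
    rewrite app_nil_r; split; [exact Hdom|lia].
  - destruct i as [|i].
    { exists nu, k; unfold state; simpl; rewrite app_nil_r; split; [exact Hdom|lia]. }
    assert (Hshift : forall j, state mu (v :: vs) (S j) = state (mu ++ mv_delta v) vs j)
      by (intros j; unfold state; simpl; apply app_assoc).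
    assert (H0 := Hst 0%nat ltac:(lia)); unfold state in H0; simpl in H0; rewrite app_nil_r in H0.
    assert (H1 := Hst 1%nat ltac:(simpl; lia)); rewrite Hshift in H1.
    unfold state in H1; simpl in H1; rewrite app_nil_r in H1.
    destruct (Hvs v (or_introl eq_refl)) as [Hv HvK].
    assert (Hdom' := dominates_step r n lam K mu nu k v Hlam HrK Hv HvK
                       (proj1 H0) (proj2 H0) (proj1 H1) Hdom).
    destruct (IH (fun w Hw => Hvs w (or_intror Hw)) (mu ++ mv_delta v) _ _
      (fun j Hj => eq_ind _ (fun m => IsDist m /\ mass_gt m r <= n)
                     (Hst (S j) (le_n_S _ _ Hj)) _ (Hshift j)) Hdom' i ltac:(simpl in Hi; lia))
      as [nu' [k' [Hd Hk]]].
    exists nu', k'; rewrite Hshift; split; [exact Hd|].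
    revert Hk; unfold count_center_gt, center_gt; simpl.
    destruct (Rlt_dec r (mv_center v)); simpl; lia.
Qed.

(** * Consequences for the running maximum *)

Lemma mumax_ge mu vs a i :
  (i <= length vs)%nat -> mass_gt (state mu vs i) a <= mumax_gt mu vs a.
Proof.
  intros Hi; unfold mumax_gt.
  assert (Hin : In i (seq 0 (S (length vs)))) by (apply in_seq; lia).
  induction (seq 0 (S (length vs))) as [|j l IH]; [destruct Hin|].
  simpl; destruct Hin as [->|Hin]; [apply Rmax_l|].
  apply Rle_trans with (1 := IH Hin), Rmax_r.
Qed.

Lemma mumax_le mu vs a b :
  (forall i, (i <= length vs)%nat -> mass_gt (state mu vs i) a <= b) -> mumax_gt mu vs a <= b.
Proof.
  intros H; unfold mumax_gt.
  assert (Hin : forall i, In i (seq 0 (S (length vs))) -> mass_gt (state mu vs i) a <= b)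
    by (intros i Hi; apply in_seq in Hi; apply H; lia).
  induction (seq 0 (S (length vs))) as [|j l IH]; simpl.
  - specialize (H 0%nat ltac:(lia)); unfold state in H; simpl in H; rewrite app_nil_r in H; exact H.
  - apply Rmax_lub; [apply Hin; left; reflexivity|apply IH; intros i Hi; apply Hin; right; exact Hi].
Qed.

Lemma state_IsDist mu vs i :
  IsDist mu -> Applicable mu vs -> (i <= length vs)%nat -> IsDist (state mu vs i).
Proof.
  intros Hd [_ H] Hi; destruct i as [|i]; [|apply H; lia].
  unfold state; simpl; rewrite app_nil_r; exact Hd.
Qed.

(** The weight constraint at [r] bounds the counted moves by [n]. The cutoff [K] must exceed every
    interval of the sequence, so only a lower bound [K0] can be prescribed. *)
Lemma constrained_dominates r n lam K0 mu vs :
  0 <= lam -> 0 <= n -> IsDist mu -> Applicable mu vs -> WeightConstrained mu vs ->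
  mass_gt mu r = 0 -> mumax_gt mu vs r <= n ->
  exists K, K0 <= K /\ forall i, (i <= length vs)%nat ->
  exists nu k, dominates r n lam K (state mu vs i) nu k /\ INR k <= n.
Proof.
  intros Hlam Hn Hd Happ HW H0 Hmax.
  destruct (list_bounded (fun v => mv_left v + 1) vs) as [C [_ HC]].
  exists (Rmax K0 (Rmax C (r + 1))); split; [apply Rmax_l|].
  set (K := Rmax K0 _).
  assert (HK : C <= K /\ r + 1 <= K) by (unfold K; cases_R; lra).
  intros i Hi.
  destruct (dominates_run r n lam K vs Hlam (proj2 HK)) with (mu := mu) (nu := [(r + 1, n)])
    (k := 0%nat) (i := i) as [nu [k [Hdom Hk]]]; try assumption.
  - intros v Hv; split; [apply (proj1 Happ), Hv|specialize (HC v Hv); lra].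
  - intros j Hj; split; [apply state_IsDist; assumption|].
    apply Rle_trans with (2 := Hmax), mumax_ge, Hj.
  - apply dominates_init; tauto.
  - exists nu, k; split; [exact Hdom|].
    apply Rle_trans with (INR (count_center_gt vs r)); [apply le_INR, Hk|].
    apply Rle_trans with (2 := Hmax), HW.
Qed.

(** Each counted move extends the reach of [nu] by at most one, so [nu] has no excess at [y]. *)
Lemma small_weight_reach r n mu vs y :
  0 <= n -> IsDist mu -> Applicable mu vs -> WeightConstrained mu vs ->
  mass_gt mu r = 0 -> mumax_gt mu vs r <= n -> r + 1 + n <= y ->
  mumax_gt mu vs y <= 0.
Proof.
  intros Hn Hd Happ HW H0 Hmax Hy.
  destruct (constrained_dominates r n 0 0 mu vs) as [K [_ Hdom]]; try assumption; [lra|].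
  apply mumax_le; intros i Hi; destruct (Hdom i Hi) as [nu [k [D Hk]]].
  apply Req_le, mass_gt_of_excess; [apply state_IsDist; assumption|].
  apply Rle_trans with (1 := dom_excess _ _ _ _ _ _ _ D y ltac:(lra)), Req_le.
  rewrite (lsum_ext _ (fun x => 0 * x + 0 * x)).
  - rewrite (lsum_lin 0 0 (fun x => x) (fun x => x)); ring.
  - intros p Hp; pose proof (dom_reach _ _ _ _ _ _ _ D p Hp); cases_R; lra.
Qed.

Lemma mass_decay r s mu vs y :
  2 <= s -> IsDist mu -> Applicable mu vs -> WeightConstrained mu vs ->
  mass_gt mu r = 0 -> mumax_gt mu vs r <= s ^ 3 -> r + (249 / 100) * s <= y ->
  mumax_gt mu vs y <= s ^ 3 / 5.
Proof.
  intros Hs Hd Happ HW H0 Hmax Hy.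
  assert (Hp : forall j, 0 < s ^ j) by (intros j; apply pow_lt; lra).
  destruct (constrained_dominates r (s ^ 3) (3 * s ^ 2) (r + 1 + 2 * s) mu vs)
    as [K [HK Hdom]]; try assumption; try (apply Rlt_le, Hp).
  { specialize (Hp 2%nat); lra. }
  apply mumax_le; intros i Hi; destruct (Hdom i Hi) as [nu [k [D Hk]]].
  assert (Hsd : IsDist (state mu vs i)) by (apply state_IsDist; assumption).
  pose proof (energy_lower_bound (r + 1) s K nu ltac:(lra) HK
    (dom_nonneg _ _ _ _ _ _ _ D) (dom_right _ _ _ _ _ _ _ D)) as HL.
  pose proof (dom_energy _ _ _ _ _ _ _ D) as HE.
  pose proof (dom_excess _ _ _ _ _ _ _ D (r + 1 + s) ltac:(lra)) as HX.
  pose proof (excess_markov _ (r + 1 + s) y Hsd ltac:(lra)) as HM.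
  pose proof (mass_gt_ge0 (state mu vs i) y Hsd) as Hm0.
  set (m := mass_gt (state mu vs i) y) in *.
  assert (HE' : INR k * ((3 * s ^ 2) ^ 2 / 12) <= s ^ 3 * ((3 * s ^ 2) ^ 2 / 12)).
  { apply Rmult_le_compat_r; [|exact Hk]; pose proof (pow2_ge_0 (3 * s ^ 2)); lra. }
  (* The distance is at least [1.49 * s - 1 >= 0.99 * s], as [s >= 2]. *)
  assert (HM' : 99 / 100 * s * m <= (y - (r + 1 + s)) * m) by (apply Rmult_le_compat_r; lra).
  assert (HX' : 6 * s ^ 3 * (99 / 100 * s * m) <= 6 * s ^ 3 * lsum (hinge (r + 1 + s)) nu).
  { apply Rmult_le_compat_l; [specialize (Hp 3%nat); lra|lra]. }
  (* Upper and lower energy bounds combine as [3 / 4 + 2 / 9 = 35 / 36], giving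
     [m <= 0.164 * s ^ 3]. *)
  assert (Hfin : s ^ 4 * (6 * (99 / 100) * m) <= s ^ 4 * (35 / 36 * s ^ 3)).
  { replace (s ^ 4 * (6 * (99 / 100) * m)) with (6 * s ^ 3 * (99 / 100 * s * m)) by ring.
    replace (s ^ 4 * (35 / 36 * s ^ 3)) with (s ^ 3 * ((3 * s ^ 2) ^ 2 / 12) + 2 * s ^ 7 / 9)
      by field.
    lra. }
  apply Rmult_le_reg_l in Hfin; [|apply Hp].
  specialize (Hp 3%nat); lra.
Qed.

(** * Induction on the weight *)

Lemma no_mass_beyond c mu vs (k : nat) :
  1 / 2 <= c <= 585 / 1000 -> c ^ 3 = 1 / 5 ->
  IsDist mu -> Applicable mu vs -> WeightConstrained mu vs ->
  forall r s, 1 / 2 <= s <= 2 * (3 / 2) ^ k ->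
  mass_gt mu r = 0 -> mumax_gt mu vs r <= s ^ 3 ->
  mumax_gt mu vs (r + 6 * s - 1) <= 0.
Proof.
  intros Hc Hc3 Hd Happ HW; induction k as [|k IH]; intros r s Hs H0 Hmax;
    (* The small case rests on [s ^ 3 - 6 * s + 2 <= 0] for [1 / 2 <= s <= 2]. *)
    (destruct (Rle_dec s 2) as [Hs2|Hs2];
     [apply small_weight_reach with r (s ^ 3); try assumption; [apply pow_le; lra|nra]|]).
  - simpl in Hs; lra.
  - simpl in Hs.
    (* Restart from [r + 6 * (1 - c) * s] with [c * s] for [s]: [6 * (1 - c) >= 2.49] meets
       [mass_decay], and [c < 2 / 3] lowers [k] by one. *)
    replace (r + 6 * s - 1) with (r + 6 * (1 - c) * s + 6 * (c * s) - 1) by ring.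
    apply IH; [split; nra| |].
    + apply Rle_antisym; [|apply mass_gt_ge0, Hd].
      rewrite <- H0; apply mass_gt_antitone; [exact Hd|nra].
    + replace ((c * s) ^ 3) with (s ^ 3 / 5) by (rewrite Rpow_mult_distr, Hc3; field).
      apply mass_decay with r; try assumption; [lra|nra].
Qed.

Lemma Rpower_third_cube x : 0 < x -> Rpower x (1 / 3) ^ 3 = x.
Proof.
  intros Hx; rewrite <- Rpower_pow by apply exp_pos.
  rewrite Rpower_mult; replace (1 / 3 * INR 3) with 1 by (simpl; field).
  apply Rpower_1, Hx.
Qed.

Lemma cube_le_reg x y : 0 <= x -> 0 <= y -> x ^ 3 <= y ^ 3 -> x <= y.
Proof.
  intros Hx Hy H; destruct (Rle_dec x y) as [|Hn]; [assumption|exfalso].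
  assert (y ^ 2 <= x ^ 2) by (apply pow_incr; lra).
  assert (0 < x ^ 2) by (apply pow_lt; lra).
  simpl in *; nra.
Qed.

Theorem mainTheorem3 (r n : R) (mu0 : sdist) (vs : list move) :
  1 / 5 <= n ->
  IsDist mu0 ->
  Applicable mu0 vs ->
  WeightConstrained mu0 vs ->
  mass_gt mu0 r = 0 ->
  mumax_gt mu0 vs r <= n ->
  mumax_gt mu0 vs (r + 6 * Rpower n (1 / 3) - 1) = 0.
Proof.
  intros Hn Hd Happ HW H0 Hmax.
  set (s := Rpower n (1 / 3)); set (c := Rpower (1 / 5) (1 / 3)).
  assert (Hs3 : s ^ 3 = n) by (apply Rpower_third_cube; lra).
  assert (Hc3 : c ^ 3 = 1 / 5) by (apply Rpower_third_cube; lra).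
  assert (Hs : 0 < s) by apply exp_pos.
  assert (Hc : 0 < c) by apply exp_pos.
  (* Indeed [0.5 ^ 3 = 0.125] and [0.585 ^ 3 > 0.2002]. *)
  assert (Hcb : 1 / 2 <= c <= 585 / 1000)
    by (split; apply cube_le_reg; try lra; rewrite Hc3; lra).
  assert (Hsb : 1 / 2 <= s) by (apply cube_le_reg; lra).
  assert (Hk : exists k, s <= 2 * (3 / 2) ^ k).
  { destruct (Pow_x_infinity (3 / 2)) with (b := s) as [k Hk]; [rewrite Rabs_right; lra|].
    exists k; specialize (Hk k (le_n k)).
    assert (0 < (3 / 2) ^ k) by (apply pow_lt; lra).
    rewrite Rabs_right in Hk; lra. }
  destruct Hk as [k Hk].
  apply Rle_antisym.
  - apply no_mass_beyond with c k; try assumption; [split; assumption|rewrite Hs3; exact Hmax].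
  - apply Rle_trans with (mass_gt (state mu0 vs 0) (r + 6 * s - 1)); [|apply mumax_ge; lia].
    apply mass_gt_ge0, state_IsDist; auto; lia.
Qed.
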